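(* Let $m\ge n\ge 1$ be integers. Then $$\mathop{\mathrm{E}}_{U\sim\mathcal{H}_{m,m}}\left[\Pr_{S\sim\mathcal{D}_{A(U,n)}}\left[S\in B_{m,n}\right]\right]<\frac{2n^2}{m}.$$
   Context: $\mathcal{H}_{m,m}$ is the Haar measure on $m\times m$ unitary matrices. For an $m\times m$ unitary $U$, $A=A(U,n)$ is the $m\times n$ matrix formed by the first $n$ columns of $U$. $\Phi_{m,n}$ is the set of tuples $S=(s_1,\dots,s_m)$ of nonnegative integers with $s_1+\cdots+s_m=n$. $\mathcal{D}_A$ is the probability distribution on $\Phi_{m,n}$ with $$\Pr_{\mathcal{D}_A}[S]=\frac{|\mathrm{Per}(A_S)|^2}{s_1!\cdots s_m!},$$ where $A_S$ is the $n\times n$ matrix obtained by taking $s_i$ copies of the $i$-th row of $A$ for each $i$, and $\mathrm{Per}$ is the permanent. (This is the distribution of photon numbers when $n$ identical photons, one in each of the first $n$ of $m$ modes, are acted on by $U$.) $G_{m,n}\subseteq\Phi_{m,n}$ is the set of collision-free $S$, i.e. those with every $s_i\in\{0,1\}$, and $B_{m,n}=\Phi_{m,n}\setminus G_{m,n}$. *)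

(* Defs.v *)
From HB Require Import structures.
From mathcomp Require Import all_boot all_order all_fingroup all_algebra.
From mathcomp Require Import spectral complex.
From mathcomp Require Import all_classical all_reals all_analysis.

Set Implicit Arguments.
Unset Strict Implicit.
Unset Printing Implicit Defensive.

Import Order.TTheory GRing.Theory Num.Theory.
Import numFieldNormedType.Exports.
Local Open Scope classical_set_scope.
Local Open Scope ring_scope.

(* [R[i]] carries no topology in the libraries; give it the one of the norm
   [`|z|], so that ['M[R[i]]_m] gets its usual (product) topology. *)
HB.instance Definition _ (R : realType) := NormedModule.copy R[i] (R[i]^o).

(* The unitary group U(m), with the subspace topology of ['M[R[i]]_m]. *)
Definition unitary (R : realType) (m : nat) : Type :=
  [set U : 'M[R[i]]_m | U \is unitarymx].

HB.instance Definition _ (R : realType) (m : nat) :=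
  Topological.on (unitary R m).

Definition umx (R : realType) (m : nat) (U : unitary R m) : 'M[R[i]]_m := val U.

Definition mk_unitary (R : realType) (m : nat) (U : 'M[R[i]]_m)
    (hU : U \is unitarymx) : unitary R m :=
  exist _ U (mem_set (A := [set V : 'M[R[i]]_m | V \is unitarymx]) hU).

Fact umx_unitary (R : realType) (m : nat) (U : unitary R m) :
  umx U \is unitarymx.
Proof. by have /set_mem := valP U. Qed.

Fact unitarymx1 (R : realType) (m : nat) : (1%:M : 'M[R[i]]_m) \is unitarymx.
Proof. by apply/unitarymxP; rewrite trmx1 map_mx1 mulmx1. Qed.

Definition unitary1 (R : realType) (m : nat) : unitary R m :=
  mk_unitary (unitarymx1 R m).

Definition unitary_mul (R : realType) (m : nat) (V U : unitary R m) :
    unitary R m :=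
  mk_unitary (mul_unitarymx (umx_unitary V) (umx_unitary U)).

HB.instance Definition _ (R : realType) (m : nat) :=
  isPointed.Build (unitary R m) (unitary1 R m).

(* U(m) as a measurable space, with its Borel sigma-algebra. *)
Definition unitary_borel (R : realType) (m : nat) :=
  g_sigma_algebraType (@open (unitary R m)).

(* The normalized Haar measure of the compact group U(m). Left invariance
   characterizes it, and right invariance follows, so only the former is
   required. *)
Definition is_haar (R : realType) (m : nat)
    (mu : probability (unitary_borel R m) R) : Prop :=
  forall (V : unitary R m) (A : set (unitary_borel R m)),
    measurable A -> mu (unitary_mul V @^-1` A) = mu A.

Definition permanent (K : comNzRingType) (n : nat) (M : 'M[K]_n) : K :=
  \sum_(s : 'S_n) \prod_(i < n) M i (s i).

Definition first_cols (K : Type) (m n : nat) (hnm : (n <= m)%N)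
    (U : 'M[K]_m) : 'M[K]_(m, n) :=
  colsub (widen_ord hnm) U.

(* Phi_{m,n}; a tuple of naturals with sum n has all its entries at most n,
   hence the codomain ['I_n.+1]. *)
Definition Phi (m n : nat) : {set {ffun 'I_m -> 'I_n.+1}} :=
  [set S : {ffun 'I_m -> 'I_n.+1} | (\sum_i (S i : nat))%N == n]%SET.

Definition Gset (m n : nat) : {set {ffun 'I_m -> 'I_n.+1}} :=
  [set S in Phi m n | [forall i, ((S i : nat) == 0%N) || ((S i : nat) == 1%N)]]%SET.

Definition Bset (m n : nat) : {set {ffun 'I_m -> 'I_n.+1}} :=
  (Phi m n :\: Gset m n)%SET.

(* The matrix A_S: the rows of A listed in order, the i-th one repeated
   [S i] times. For [S \in Phi m n] the list has exactly n elements, so the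
   default value of [nth] is not used. *)
Definition repeat_rows (K : nzRingType) (m n : nat) (A : 'M[K]_(m, n))
    (S : {ffun 'I_m -> 'I_n.+1}) : 'M[K]_n :=
  \matrix_(j < n) nth 0 (flatten [seq nseq (S i) (row i A) | i <- enum 'I_m]) j.

(* Pr_{D_A}[S]. [normc] is the complex modulus with values in R. *)
Definition boson_pmf (R : realType) (m n : nat) (A : 'M[R[i]]_(m, n))
    (S : {ffun 'I_m -> 'I_n.+1}) : R :=
  ComplexField.Normc.normc (permanent (repeat_rows A S)) ^+ 2
    / (\prod_i (S i)`!)%N%:R.

Definition boson_prob (R : realType) (m n : nat) (A : 'M[R[i]]_(m, n))
    (E : {set {ffun 'I_m -> 'I_n.+1}}) : R :=
  \sum_(S in E) boson_pmf A S.

(* Main.v *)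
(** For a collision to occur, some two of the [n] photons must land in the same
    mode. Labelling the photons (functions [g : 'I_n -> 'I_m] instead of
    occupation numbers [S]) and summing over coinciding pairs [g a = g b], the
    orthonormality of the columns of [A] leaves only two terms in the square of
    each permanent, so the probability of [B_{m,n}] is at most the sum over
    [i] and [j <> k] of [|A_ij|^2 |A_ik|^2], hence, by AM-GM, at most
    [(n - 1) * sum_ij |A_ij|^4]. Left invariance under the unitaries that mix two
    rows by [(e_i + w e_k) / sqrt 2] with [w] a fourth root of unity gives
    [E|U_ij|^4 = 2 E|U_ij|^2|U_kj|^2], and as the columns are unit vectors
    [E|U_ij|^4 = 2 / (m (m + 1))]. The expected probability is therefore at most
    [2 n (n - 1) / (m + 1)]. *)

Require Import Defs.
From HB Require Import structures.
From mathcomp Require Import all_boot all_order all_fingroup all_algebra.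
From mathcomp Require Import spectral complex.
From mathcomp Require Import all_classical all_reals all_analysis.
From mathcomp Require Import measurable_realfun ring lra.
Import Order.TTheory GRing.Theory Num.Theory.
Import numFieldNormedType.Exports.
Local Open Scope ring_scope.

Set Implicit Arguments.
Unset Strict Implicit.
Unset Printing Implicit Defensive.

(** * Counting permutations compatible with a map *)

(** A permutation preserving every fibre of [f] is determined by its restrictions to the fibres, so
    these permutations inject into the product of the symmetric groups of the fibres. *)
Lemma card_fiber_stab_le (I J : finType) (f : I -> J) :
  (#|[set s : {perm I} | [forall x, f (s x) == f x]]%SET|
     <= \prod_y (#|[set x | f x == y]%SET|)`!)%N.
Proof.
set X := [set s : {perm I} | _]%SET.
pose F y := [set x | f x == y]%SET.
pose r (s : {perm I}) := [ffun y => restr_perm (F y) s].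
have rE s x : s \in X -> restr_perm (F (f x)) s x = s x.
  rewrite inE => /forallP sX.
  apply: restr_permE; last by rewrite inE.
  by apply/astabsP => z; rewrite /= apermE !inE (eqP (sX z)).
have rinj : {in X &, injective r}.
  move=> s t sX tX rst; apply/permP => x.
  by rewrite -(rE s)// -(rE t)//; move/ffunP/(_ (f x)): rst; rewrite !ffunE => ->.
rewrite -(card_in_imset rinj).
have -> : (\prod_y (#|[set x | f x == y]%SET|)`! = #|(family (fun y => mem (Sym (F y))))|)%N.
  rewrite card_family foldrE big_map big_enum/=.
  by apply: eq_bigr => y _; rewrite card_Sym.
apply: subset_leq_card; apply/fintype.subsetP => _ /imsetP[s sX ->].
by apply/familyP => y; rewrite ffunE /= inE restr_perm_on.
Qed.

(** Composing with the inverse of one solution [s0] sends every solution to a permutation preserving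
    the fibres of [f]. *)
Lemma card_perm_factor_le (I J : finType) (f g : I -> J) :
  (#|[set s : {perm I} | [forall x, f (s x) == g x]]%SET|
     <= \prod_y (#|[set x | f x == y]%SET|)`!)%N.
Proof.
set X := [set s | _]%SET.
have [->|[s0 s0X]] := set_0Vmem X; first by rewrite cards0.
apply: leq_trans (card_fiber_stab_le f).
rewrite -(card_imset _ (mulgI s0^-1%g)).
apply: subset_leq_card; apply/fintype.subsetP => _ /imsetP[s sX ->].
rewrite inE; apply/forallP => x; rewrite permM.
move: sX s0X; rewrite !inE => /forallP sX /forallP s0X.
by rewrite (eqP (sX _)) -(eqP (s0X _)) permKV.
Qed.

(** * Occupation numbers and labelled photons *)

(** The canonical labelling of occupation [S], with the photons listed mode by mode. [i0] is the
    default of [nth], out of reach when [S \in Phi m n]. *)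
Definition rep_fun (m n : nat) (i0 : 'I_m) (S : {ffun 'I_m -> 'I_n.+1}) (j : 'I_n) :=
  nth i0 (flatten [seq nseq (S i) i | i <- enum 'I_m]) j.

Section RepFun.
Variables (m n : nat) (i0 : 'I_m) (S : {ffun 'I_m -> 'I_n.+1}).
Hypothesis SPhi : S \in Phi m n.

Lemma size_rep : size (flatten [seq nseq (S i) i | i <- enum 'I_m]) = n.
Proof.
rewrite size_flatten /shape -map_comp sumnE big_map big_enum /=.
under eq_bigr do rewrite size_nseq.
by move: SPhi; rewrite inE => /eqP.
Qed.

Lemma repeat_rowsE (K : nzRingType) (A : 'M[K]_(m, n)) :
  repeat_rows A S = rowsub (rep_fun i0 S) A.
Proof.
apply/matrixP => j k; rewrite !mxE.
have -> : [seq nseq (S i) (row i A) | i <- enum 'I_m] =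
   map (map (fun i => row i A)) [seq nseq (S i) i | i <- enum 'I_m].
  by elim: (enum 'I_m) => //= i s ->; rewrite map_nseq.
rewrite -map_flatten (nth_map i0) ?size_rep//.
by rewrite mxE.
Qed.

Lemma card_rep_fun i : #|[set j | rep_fun i0 S j == i]%SET| = S i.
Proof.
rewrite cardsE cardE size_filter.
transitivity (count_mem i (map (rep_fun i0 S) (enum 'I_n))).
  by rewrite count_map enumT. 
have -> : map (rep_fun i0 S) (enum 'I_n) = flatten [seq nseq (S i) i | i <- enum 'I_m].
  apply: (@eq_from_nth _ i0); first by rewrite size_map size_enum_ord size_rep.
  move=> k; rewrite size_map size_enum_ord => kn.
  by rewrite (nth_map (Ordinal kn)) ?size_enum_ord// /rep_fun nth_enum_ord.
rewrite count_flatten -map_comp sumnE big_map big_enum /=.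
rewrite (bigD1 i)//= big1 => [|j ji]; rewrite count_nseq /= ?eqxx ?mul1n ?addn0//.
by rewrite (negbTE ji).
Qed.
End RepFun.

(** [inord] truncates nothing, as a fibre of [g] has at most [n] elements. *)
Definition occ (m n : nat) (g : {ffun 'I_n -> 'I_m}) : {ffun 'I_m -> 'I_n.+1} :=
  [ffun i => inord #|[set j | g j == i]%SET|].

Lemma occE m n (g : {ffun 'I_n -> 'I_m}) i : occ g i = #|[set j | g j == i]%SET| :> nat.
Proof. by rewrite ffunE inordK// ltnS -[X in (_ <= X)%N]card_ord max_card. Qed.

Lemma occ_Bset m n (g : {ffun 'I_n -> 'I_m}) : occ g \in Bset m n -> ~~ injectiveb g.
Proof.
rewrite !inE => /andP[nG gPhi]; apply: contra nG => /injectiveP ginj.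
rewrite gPhi /=; apply/forallP => i; rewrite !occE.
suff : (#|[set j | g j == i]%SET| <= 1)%N by case: #|_| => [|[|]].
apply/card_le1_eqP => j k; rewrite !inE => /eqP gj /eqP gk.
by apply: ginj; rewrite gj gk.
Qed.

(* Each of the [n!] permutations turns [rep_fun i0 S] into some [g] of occupation
   [S], and each such [g] is reached by at most [\prod_i (S i)!] permutations. *)
Lemma sum_Bset_le (C : numFieldType) (m n : nat) (i0 : 'I_m) (w : {ffun 'I_n -> 'I_m} -> C) :
  (forall g, 0 <= w g) ->
  (forall (g : {ffun 'I_n -> 'I_m}) (s : 'S_n), w [ffun j => g (s j)] = w g) ->
  n`!%:R * \sum_(S in Bset m n) w [ffun j => rep_fun i0 S j] / (\prod_i (S i)`!)%N%:R
    <= \sum_(g : {ffun 'I_n -> 'I_m} | ~~ injectiveb g) w g.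
Proof.
move=> w0 wperm.
(* A labelling with occupation in [Bset m n] is not injective, and [0 <= w g] permits enlarging the
   index set. *)
apply: (@le_trans _ _ (\sum_(g : {ffun 'I_n -> 'I_m} | occ g \in Bset m n) w g)); last first.
  rewrite [leRHS]big_mkcond [leLHS]big_mkcond; apply: ler_sum => g _.
  case: ifPn => [/occ_Bset ->//|_]; by case: ifP.
rewrite (partition_big (@occ m n) (mem (Bset m n)))//= mulr_sumr.
apply: ler_sum => S SB.
have SPhi : S \in Phi m n by move: SB; rewrite inE => /andP[].
set f := [ffun j => _].
rewrite mulrA ler_pdivrMr; last by rewrite ltr0n prodn_gt0// => i; rewrite fact_gt0.
have -> : n`!%:R * w f = \sum_(s : 'S_n) w [ffun j => f (s j)].
  under eq_bigr do rewrite wperm.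
  by rewrite sumr_const card_Sn mulr_natl.
rewrite (partition_big (fun s : 'S_n => [ffun j => f (s j)])
  (fun g => (occ g \in Bset m n) && (occ g == S)))/=; last first.
  move=> s _; suff -> : occ [ffun j => f (s j)] = S by rewrite SB eqxx.
  apply/ffunP => i; apply/val_inj; rewrite /= occE -[RHS](card_rep_fun i0 SPhi).
  rewrite -[RHS](card_preimset _ (@perm_inj _ s)).
  by apply: eq_card => j; rewrite !inE !ffunE.
rewrite mulr_suml; apply: ler_sum => g _.
rewrite (eq_bigr (fun=> w g)) => [|s /eqP ->//].
rewrite sumr_const -[w g *+ _]mulr_natr ler_wpM2l// ler_nat.
apply: leq_trans (leq_trans (card_perm_factor_le (fun j : 'I_n => f j) g) _).
  apply: subset_leq_card; apply/fintype.subsetP => s.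
  rewrite inE => /(eqP (x := [ffun j => f (s j)])) <-.
  by apply/forallP => x; rewrite [X in _ == X]ffunE.
apply: leq_prod => i _; apply: eq_leq; congr (_`!).
rewrite -[RHS](card_rep_fun i0 SPhi); apply: eq_card => j; by rewrite !inE ffunE.
Qed.

(** * Permanents summed over labellings with a coincidence *)

Lemma permanent_rowsub_perm (K : comNzRingType) m n (A : 'M[K]_(m, n))
    (g : 'I_n -> 'I_m) (s : 'S_n) :
  permanent (rowsub (fun j => g (s j)) A) = permanent (rowsub g A).
Proof.
rewrite /permanent (reindex_inj (mulgI s))/=; apply: eq_bigr => t _.
rewrite [RHS](reindex_inj (@perm_inj _ s)).
by apply: eq_bigr => j _; rewrite !mxE permM.
Qed.

(** Once the common value of [g a] and [g b] is fixed, the other coordinates are free and the sum of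
    products factors. *)
Lemma sum_ffun_coincide (K : comNzRingType) m n (a b : 'I_n) (F : 'I_n -> 'I_m -> K) :
  a != b ->
  \sum_(g : {ffun 'I_n -> 'I_m} | g a == g b) \prod_j F j (g j)
  = (\sum_i F a i * F b i) * \prod_(j | (j != a) && (j != b)) \sum_i F j i.
Proof.
move=> ab.
rewrite (partition_big (fun g : {ffun 'I_n -> 'I_m} => g a) predT)//= mulr_suml.
apply: eq_bigr => i _.
(* [Q] pins the coordinates [a] and [b] to [i], so that the constrained sum runs over a product
   set. *)
pose Q (j : 'I_n) : pred 'I_m := fun x => (j \in [:: a; b]) ==> (x == i).
transitivity (\sum_(g in family Q) \prod_j F j (g j)).
  apply: eq_bigl => g; apply/andP/familyP => [[/eqP gab /eqP ga] j|gQ].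
    rewrite unfold_in /Q !inE; case: eqP => [->|_]; first by rewrite ga eqxx.
    by case: eqP => [->|//]; rewrite -gab ga eqxx.
  have ga : g a == i by have := gQ a; rewrite unfold_in /Q mem_head.
  have gb : g b == i by have := gQ b; rewrite unfold_in /Q !inE eqxx orbT.
  by rewrite (eqP ga) (eqP gb) eqxx.
rewrite -(bigA_distr_big_dep Q).
rewrite (bigD1 a)//= (bigD1 b)//=; last by rewrite eq_sym.
rewrite mulrA; congr (_ * _ * _).
- by apply: big_pred1 => x; rewrite /Q mem_head.
- by apply: big_pred1 => x; rewrite /Q (_ : b \in _) // !inE eqxx orbT.
- apply: eq_bigr => j /andP[ja jb]; apply: eq_bigl => x.
  by rewrite /Q (_ : j \in _ = false) // !inE (negbTE ja) (negbTE jb).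
Qed.

(** [t * s^-1] fixes every point other than [a] and [b], so it is the identity or their
    transposition. *)
Lemma perm_eq_off2 (I : finType) (a b : I) (s t : {perm I}) :
  a != b -> (forall j, j != a -> j != b -> s j = t j) -> t = s \/ t = (tperm a b * s)%g.
Proof.
move=> ab st.
pose p := (t * s^-1)%g.
have tE : t = (p * s)%g by rewrite /p mulgKV.
have pfix j : j != a -> j != b -> p j = j.
  by move=> ja jb; rewrite /p permM -st// permK.
have pin j : (j == a) || (j == b) -> (p j == a) || (p j == b).
  apply: contraTT; rewrite !negb_or => /andP[pa pb].
  have /perm_inj e := pfix _ pa pb; by rewrite -{1}e pa -{1}e pb.
have pa : (p a == a) || (p a == b) by apply: pin; rewrite eqxx.
have pb : (p b == a) || (p b == b) by apply: pin; rewrite eqxx orbT.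
have pab : p a != p b by rewrite (inj_eq perm_inj).
case/orP: pa => /eqP pa; [left|right]; rewrite tE.
  have -> : p = 1%g; last by rewrite mul1g.
  apply/permP => j; rewrite perm1.
  have [->//|ja] := eqVneq j a; have [->|jb] := eqVneq j b; last exact: pfix.
  by move: pb pab; rewrite pa => /orP[/eqP ->|/eqP//]; rewrite eqxx.
congr (_ * _)%g; apply/permP => j.
have [->|ja] := eqVneq j a; first by rewrite tpermL.
have [->|jb] := eqVneq j b; last by rewrite tpermD 1?eq_sym// pfix.
by rewrite tpermR; move: pb pab; rewrite pa => /orP[/eqP//|/eqP ->]; rewrite eqxx.
Qed.

Section Coincidence.
Variables (C : numClosedFieldType) (m n : nat) (A : 'M[C]_(m, n)).
Hypothesis hA : forall j k, \sum_i A i j * (A i k)^* = (j == k)%:R.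

(** Expanding the square gives a sum over pairs [s], [t]. Summing over the free labels yields inner
    products of columns, which vanish unless [t] agrees with [s] off [a] and [b]; the two such [t]
    contribute equally. *)
Lemma sum_permanent_coincide (a b : 'I_n) : a != b ->
  \sum_(g : {ffun 'I_n -> 'I_m} | g a == g b) `|permanent (rowsub g A)| ^+ 2
  = (\sum_(s : 'S_n) \sum_i `|A i (s a)| ^+ 2 * `|A i (s b)| ^+ 2) *+ 2.
Proof.
move=> ab.
under eq_bigr => g _.
  rewrite normCK /permanent rmorph_sum mulr_suml.
  under eq_bigr => s _.
    rewrite mulr_sumr.
    under eq_bigr => t _.
      rewrite rmorph_prod -big_split /=.
      under eq_bigr do rewrite !mxE.
      over.
    over.
  over.
rewrite exchange_big /= -sumrMnl; apply: eq_bigr => s _.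
rewrite exchange_big /=.
pose F t j i := A i (s j) * (A i ((t : 'S_n) j))^*.
under eq_bigr => t _ do rewrite (sum_ffun_coincide (F t) ab).
have nts : (tperm a b * s)%g != s.
  apply/eqP => /permP/(_ a); rewrite permM tpermL => /perm_inj ba.
  by rewrite ba eqxx in ab.
rewrite (bigD1 s)//= (bigD1 (tperm a b * s)%g)//= [X in _ + (_ + X)]big1 ?addr0; last first.
  move=> t /andP[ts tts].
  have [/existsP[j /and3P[ja jb st]]|] := boolP [exists j, [&& j != a, j != b & s j != t j]].
    rewrite (bigD1 j) ?ja//= [X in _ * (X * _)]hA (negbTE st).
    by rewrite mul0r mulr0.
  move=> /existsPn H.
  have [] := perm_eq_off2 (s := s) (t := t) ab.
  - move=> j ja jb; apply/eqP; move: (H j); by rewrite ja jb/= negbK.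
  - by move=> e; rewrite e eqxx in ts.
  - by move=> e; rewrite e eqxx in tts.
rewrite mulr2n; congr (_ + _).
  rewrite [X in _ * X]big1 ?mulr1; last by move=> j _; rewrite hA eqxx.
  by apply: eq_bigr => i _; rewrite !normCK /F.
rewrite [X in _ * X]big1 ?mulr1; last first.
  by move=> j /andP[ja jb]; rewrite /F permM tpermD 1?eq_sym// hA eqxx.
by apply: eq_bigr => i _; rewrite !normCK /F !permM tpermL tpermR; ring.
Qed.

(** A noninjective [g] has a coinciding pair, hence two ordered ones, [(a, b)] and [(b, a)]; this
    absorbs the factor 2 of [sum_permanent_coincide]. *)
Lemma sum_permanent_noninjective :
  \sum_(g : {ffun 'I_n -> 'I_m} | ~~ injectiveb g) `|permanent (rowsub g A)| ^+ 2
  <= n`!%:R * \sum_j \sum_(k | k != j) \sum_i `|A i j| ^+ 2 * `|A i k| ^+ 2.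
Proof.
set w := fun g : {ffun 'I_n -> 'I_m} => `|permanent (rowsub g A)| ^+ 2.
rewrite -(@ler_pMn2r _ 2)//.
apply: (@le_trans _ _ (\sum_a \sum_(b | b != a) \sum_(g : {ffun 'I_n -> 'I_m} | g a == g b) w g)).
  under [leRHS]eq_bigr do rewrite (exchange_big_dep predT)//=.
  rewrite [leRHS]exchange_big /= [X in X *+ 2]big_mkcond -sumrMnl; apply: ler_sum => g _.
  have w0 : 0 <= w g by rewrite exprn_ge0.
  pose T a := \sum_(b | (b != a) && (g a == g b)) w g.
  have T0 a : 0 <= T a by apply: sumr_ge0.
  have wT a b : b != a -> g a = g b -> w g <= T a.
    by move=> ba gab; rewrite /T (bigD1 b) ?ba ?gab ?eqxx//= lerDl sumr_ge0.
  rewrite -[leRHS]/(\sum_a T a).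
  case: ifPn => [|_]; last by rewrite mul0rn; apply: sumr_ge0.
  move=> /injectivePn[a [b ab gab]].
  rewrite (bigD1 a)//= (bigD1 b) 1?eq_sym//= addrA mulr2n.
  rewrite -[leLHS]addr0 lerD ?sumr_ge0//.
  by rewrite lerD ?(wT a b) ?(wT b a)// eq_sym.
under eq_bigr => a _.
  under eq_bigr => b ba.
    rewrite sum_permanent_coincide 1?eq_sym//.
    over.
  rewrite sumrMnl exchange_big /=.
  over.
rewrite sumrMnl exchange_big /=.
(* Reindexing the columns by [s] makes all [n!] summands equal. *)
rewrite ler_pMn2r// (eq_bigr (fun=> \sum_j \sum_(k | k != j) \sum_i `|A i j| ^+ 2 * `|A i k| ^+ 2)); last first.
  move=> s _; rewrite [RHS](reindex_inj (@perm_inj _ s)); apply: eq_bigr => a _.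
  rewrite [RHS](reindex_inj (@perm_inj _ s)); apply: eq_bigl => b.
  by rewrite (inj_eq perm_inj).
by rewrite sumr_const card_Sn mulr_natl.
Qed.

(** After doubling, [2xy <= x^2 + y^2] applies; each column has [n - 1] partners in either position
    of the pair, and the resulting [2 (n - 1)] cancels the doubling. *)
Lemma sum_offdiag_le :
  \sum_j \sum_(k | k != j) \sum_i `|A i j| ^+ 2 * `|A i k| ^+ 2
  <= n.-1%:R * \sum_i \sum_j `|A i j| ^+ 4.
Proof.
rewrite -(@ler_pMn2r _ 2)// -sumrMnl.
apply: (@le_trans _ _ (\sum_j \sum_(k | k != j) \sum_i (`|A i j| ^+ 4 + `|A i k| ^+ 4))).
  apply: ler_sum => j _; rewrite -sumrMnl; apply: ler_sum => k _.
  rewrite -sumrMnl; apply: ler_sum => i _.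
  rewrite -subr_ge0 (_ : _ - _ = (`|A i j| ^+ 2 - `|A i k| ^+ 2) ^+ 2); last by ring.
  by rewrite real_exprn_even_ge0// realB// realX// normr_real.
pose q j := \sum_i `|A i j| ^+ 4.
under eq_bigr do under eq_bigr do rewrite big_split /= -!/(q _).
under eq_bigr do rewrite big_split /=.
rewrite big_split /= [X in _ + X](exchange_big_dep predT)//=.
rewrite [X in _ + X](eq_bigr (fun j => \sum_(k | k != j) q j)); last first.
  by move=> j _; apply: eq_bigl => k; rewrite eq_sym.
rewrite -mulr2n ler_pMn2r// [X in _ <= _ * X]exchange_big mulr_sumr /=.
apply: ler_sum => j _; rewrite sumr_const mulr_natl -/(q j).
by rewrite cardC1 card_ord.
Qed.

(** The factor [n!] gained by labelling the photons cancels against the one in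
    [sum_permanent_noninjective]. *)
Lemma sum_Bset_permanent_le (i0 : 'I_m) :
  \sum_(S in Bset m n) `|permanent (repeat_rows A S)| ^+ 2 / (\prod_i (S i)`!)%N%:R
  <= n.-1%:R * \sum_i \sum_j `|A i j| ^+ 4.
Proof.
apply: le_trans sum_offdiag_le.
rewrite -(@ler_pM2l _ n`!%:R) ?ltr0n ?fact_gt0//.
apply: le_trans sum_permanent_noninjective.
pose w (g : {ffun 'I_n -> 'I_m}) := `|permanent (rowsub g A)| ^+ 2.
have := @sum_Bset_le C m n i0 w.
rewrite (eq_bigr (fun S => `|permanent (repeat_rows A S)| ^+ 2 / (\prod_i (S i)`!)%N%:R)); last first.
  move=> S SB; congr (_ ^+ 2 / _); congr `|permanent _|.
  rewrite (repeat_rowsE i0); last by move: SB; rewrite inE => /andP[].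
  by apply/matrixP => j k; rewrite !mxE ffunE.
apply.
  by move=> g; rewrite exprn_ge0.
move=> g s; rewrite /w -(permanent_rowsub_perm A g s); congr (`|permanent _| ^+ 2).
by apply/matrixP => j k; rewrite !mxE ffunE.
Qed.
End Coincidence.

(** * Squared moduli and two-row unitaries *)

Section SquaredModulus.
Variable R : realType.
Implicit Types z w : R[i].

(** A real polynomial in the coordinates, which suits both [ring] and measurability. *)
Definition sqmod z : R := complex.Re z ^+ 2 + complex.Im z ^+ 2.

Lemma sqmod_ge0 z : 0 <= sqmod z.
Proof. by rewrite addr_ge0 ?sqr_ge0. Qed.

Lemma sqmodE z : (sqmod z)%:C%C = `|z| ^+ 2.
Proof. by rewrite add_Re2_Im2. Qed.

Lemma sqr_normc_sqmod z : ComplexField.Normc.normc z ^+ 2 = sqmod z.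
Proof. by case: z => a b; rewrite /= sqr_sqrtr// addr_ge0 ?sqr_ge0. Qed.

Lemma sqmodM z w : sqmod (z * w) = sqmod z * sqmod w.
Proof. by case: z w => a b [c d]; rewrite /sqmod /=; ring. Qed.

(** With [p = |z|^2 + |w|^2], each term is the square of [p] plus twice a real part. Opposite phases
    cancel the parts linear in it, and the quadratic ones add up to [8 |z|^2 |w|^2]. *)
Lemma sum_sqr_sqmod_phases z w :
  sqmod (z + 1 * w) ^+ 2 + sqmod (z + (-1) * w) ^+ 2
  + sqmod (z + 'i%C * w) ^+ 2 + sqmod (z + (- 'i%C) * w) ^+ 2
  = 4 * (sqmod z ^+ 2 + sqmod w ^+ 2 + 4 * (sqmod z * sqmod w)).
Proof. by case: z w => a b [c d]; rewrite /sqmod /=; ring. Qed.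
End SquaredModulus.

Section Hadamard.
Variables (R : realType) (m : nat) (i k : 'I_m) (w : R[i]).
Hypotheses (ik : i != k) (w1 : w * w^* = 1).

Let c : R[i] := ((Num.sqrt 2)^-1)%:C%C.

(** The Hadamard gate on the coordinates [i] and [k], applied after a phase [w] on coordinate
    [k]. *)
Definition hadamard_mx : 'M[R[i]]_m := \matrix_(a, b)
  if a == i then c * ((b == i)%:R + w * (b == k)%:R)
  else if a == k then c * ((b == i)%:R - w * (b == k)%:R)
  else (a == b)%:R.

(** A general [f] serves two purposes: a conjugated row gives unitarity, and a column of [U] gives
    the entries of the product with [U]. *)
Lemma sum_hadamard_mx a (f : 'I_m -> R[i]) :
  \sum_b hadamard_mx a b * f b =
  if a == i then c * (f i + w * f k) else if a == k then c * (f i - w * f k) else f a.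
Proof.
have pick x : \sum_b (b == x)%:R * f b = f x.
  by rewrite (bigD1 x)//= eqxx mul1r big1 ?addr0// => b /negbTE ->; rewrite mul0r.
rewrite -(pick i) -(pick k) -[f a](pick a).
under eq_bigr do rewrite mxE.
case: (a == i); first by rewrite mulrDr !mulr_sumr -big_split; apply: eq_bigr => b _ /=; ring.
case: (a == k); first by rewrite mulrBr !mulr_sumr -sumrB; apply: eq_bigr => b _ /=; ring.
by apply: eq_bigr => b _; rewrite eq_sym.
Qed.

Lemma sqr_invsqrt2 : c * c = 2^-1.
Proof.
rewrite /c -rmorphM /= -invfM -expr2 sqr_sqrtr//.
by rewrite fmorphV rmorph_nat.
Qed.

Lemma conj_invsqrt2 : c^* = c.
Proof. by apply/conj_Creal/complex_realP; exists (Num.sqrt 2)^-1. Qed.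

Lemma hadamard_mx_unitary : hadamard_mx \is unitarymx.
Proof.
apply/unitarymxP/matrixP => a b; rewrite !mxE.
transitivity (\sum_l hadamard_mx a l * (hadamard_mx b l)^*).
  by apply: eq_bigr => l _; rewrite [in RHS]/hadamard_mx !mxE.
rewrite (sum_hadamard_mx a (fun l => (hadamard_mx b l)^*)) !mxE !eqxx [k == i]eq_sym (negbTE ik).
have cc := sqr_invsqrt2; have cJ := conj_invsqrt2.
have cc2 : c * (c + c) = 1 by rewrite mulrDr cc; field.
have simp := (mulr0, addr0, add0r, subr0, sub0r, mulr1, mulrN, oppr0).
have ki : (k == i) = false by rewrite eq_sym (negbTE ik).
have conjc x : (c * x)^* = c * x^* by rewrite rmorphM /= cJ.
(* Nine cases, as each of [a] and [b] is [i], [k] or another index. *)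
have [ai|ai] := eqVneq a i; last have [ak|ak] := eqVneq a k.
- have [bi|bi] := eqVneq b i; last have [bk|bk] := eqVneq b k => /=.
  + by rewrite ai bi eqxx !simp cJ conjc mulrCA w1 mulr1 cc2.
  + by rewrite ai bk (negbTE ik) !simp cJ rmorphN /= conjc mulrN mulrCA w1 mulr1 subrr mulr0.
  + by rewrite ai eq_sym (negbTE bi) !rmorph0 !simp.
- have [bi|bi] := eqVneq b i; last have [bk|bk] := eqVneq b k => /=.
  + by rewrite ak bi ki !simp cJ conjc mulrCA w1 mulr1 subrr mulr0.
  + by rewrite ak bk eqxx !simp cJ rmorphN /= conjc mulrN opprK mulrCA w1 mulr1 cc2.
  + by rewrite ak eq_sym (negbTE bk) !rmorph0 !simp.
- have [bi|bi] := eqVneq b i; last have [bk|bk] := eqVneq b k => /=.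
  + by rewrite bi (negbTE ai) !simp rmorph0.
  + by rewrite bk (negbTE ak) !simp rmorph0.
  + by rewrite rmorph_nat eq_sym.
Qed.

End Hadamard.

(** * Measurability of functions of the matrix entries *)

Section Measurability.
Variables (R : realType) (m : nat).
Let T := unitary_borel R m.

(** Going through the two real coordinates leaves only the Borel sets of [R] to consider. *)
Definition cmeasurable (f : T -> R[i]) : Prop :=
  measurable_fun [set: T]%classic (fun U => complex.Re (f U)) /\
  measurable_fun [set: T]%classic (fun U => complex.Im (f U)).

Lemma cmeasurable_cst z : cmeasurable (fun=> z).
Proof. by split; exact: measurable_cst. Qed.

Lemma cmeasurableD f g : cmeasurable f -> cmeasurable g ->
  cmeasurable (fun U => f U + g U).
Proof.
move=> [f1 f2] [g1 g2]; split.
  under eq_fun do rewrite raddfD; exact: measurable_funD.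
by under eq_fun do rewrite raddfD; exact: measurable_funD.
Qed.

Lemma cmeasurableM f g : cmeasurable f -> cmeasurable g ->
  cmeasurable (fun U => f U * g U).
Proof.
move=> [f1 f2] [g1 g2]; split.
  rewrite (_ : (fun U => _) = (fun U => complex.Re (f U) * complex.Re (g U)
    - complex.Im (f U) * complex.Im (g U))).
    by apply: measurable_funB; apply: measurable_funM.
  by apply/funext => U; case: (f U) (g U) => a b [].
rewrite (_ : (fun U => _) = (fun U => complex.Re (f U) * complex.Im (g U)
  + complex.Im (f U) * complex.Re (g U))).
  by apply: measurable_funD; apply: measurable_funM.
by apply/funext => U; case: (f U) (g U) => a b [].
Qed.

Lemma cmeasurable_sum I (s : seq I) (f : I -> T -> R[i]) :
  (forall i, cmeasurable (f i)) -> cmeasurable (fun U => \sum_(i <- s) f i U).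
Proof.
move=> mf; elim: s => [|i s IHs].
  by under eq_fun do rewrite big_nil; exact: cmeasurable_cst.
by under eq_fun do rewrite big_cons; exact: cmeasurableD.
Qed.

Lemma cmeasurable_prod I (s : seq I) (f : I -> T -> R[i]) :
  (forall i, cmeasurable (f i)) -> cmeasurable (fun U => \prod_(i <- s) f i U).
Proof.
move=> mf; elim: s => [|i s IHs].
  by under eq_fun do rewrite big_nil; exact: cmeasurable_cst.
by under eq_fun do rewrite big_cons; exact: cmeasurableM.
Qed.

(** Open intervals generate the Borel sets of [R], and their preimages are open, hence generators of
    the sigma-algebra on U(m). *)
Lemma continuous_measurable_unitary (f : unitary R m -> R) :
  continuous f -> measurable_fun [set: T]%classic (f : T -> R).
Proof.
move=> /continuousP cf; apply: (measurability _ (RGenOpens.measurableE R)).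
move=> _ [_ [a [b ->] <-]]; rewrite setTI; apply: sub_sigma_algebra.
exact/cf/interval_open.
Qed.

Lemma continuous_Re : continuous (fun z : R[i] => complex.Re z).
Proof.
move=> z A /nbhs_ballP[e /= e0 eA]; apply/nbhs_ballP.
(* Balls of [R[i]] have their radii in [R[i]], so the real radius [e] is embedded there. *)
exists e%:C%C; rewrite /= ?ltcR// => v zv.
apply: eA; rewrite /ball /= -ltcR; apply: le_lt_trans zv.
by rewrite -raddfB; exact: normc_ge_Re.
Qed.

Lemma normc_ge_Im (z : R[i]) : `|complex.Im z|%:C%C <= `|z|.
Proof.
by case: z => a b; rewrite normc_def lecR /= -sqrtr_sqr ler_wsqrtr// lerDr sqr_ge0.
Qed.

Lemma continuous_Im : continuous (fun z : R[i] => complex.Im z).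
Proof.
move=> z A /nbhs_ballP[e /= e0 eA]; apply/nbhs_ballP.
exists e%:C%C; rewrite /= ?ltcR// => v zv.
apply: eA; rewrite /ball /= -ltcR; apply: le_lt_trans zv.
by rewrite -raddfB; exact: normc_ge_Im.
Qed.

(** The inclusion of U(m) is continuous for the subspace topology, and so are the matrix
    coordinates. *)
Lemma cmeasurable_entry i j : cmeasurable (fun U => umx U i j).
Proof.
have cU : continuous (fun U : unitary R m => umx U i j).
  move=> U; apply: (@continuous_comp _ _ _ (@umx R m) (fun M : 'M[R[i]]_m => M i j)).
    exact: initial_continuous.
  exact: coord_continuous.
split; apply: continuous_measurable_unitary => U.
  by apply: (@continuous_comp _ _ _ (fun U : unitary R m => umx U i j) _ U); [exact: cU|exact: continuous_Re].
by apply: (@continuous_comp _ _ _ (fun U : unitary R m => umx U i j) _ U); [exact: cU|exact: continuous_Im].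
Qed.

Lemma measurable_sqmod f : cmeasurable f ->
  measurable_fun [set: T]%classic (fun U => sqmod (f U)).
Proof. by move=> [f1 f2]; apply: measurable_funD; apply: measurable_funX. Qed.

End Measurability.

(** * Fourth moments of the Haar measure *)

Section HaarMoments.
Variables (R : realType) (m : nat) (mu : probability (unitary_borel R m) R).
Hypothesis hmu : is_haar mu.
Let T := unitary_borel R m.

(** Invariance on sets says that [f] and its translate push [mu] forward to the same measure on [R],
    against which both integrals can be computed. *)
Lemma haar_integral_mul (V : unitary R m) (f : T -> R) :
  measurable_fun [set: T]%classic f ->
  measurable_fun [set: T]%classic (fun U : T => f (unitary_mul V U)) ->
  (forall U, 0 <= f U) ->
  (\int[mu]_U (f (unitary_mul V U))%:E = \int[mu]_U (f U)%:E)%E.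
Proof.
move=> mf mfV f0.
(* The integrand [|y|] is nonnegative on all of [R] and agrees with [y] on the values of [g]. *)
have pushE (g : T -> R) : measurable_fun [set: T]%classic g -> (forall U, 0 <= g U) ->
    (\int[mu]_U (g U)%:E = \int[pushforward mu g]_y (`|y|)%:E)%E.
  move=> mg g0; rewrite ge0_integral_pushforward//; last first.
    by apply/measurable_EFinP; exact: normr_measurable.
  by apply: eq_integral => U _; rewrite /= ger0_norm.
rewrite pushE// (pushE f)//.
apply: eq_measure_integral => A mA _; rewrite /pushforward.
transitivity (mu (unitary_mul V @^-1` (f @^-1` A))%classic) => //.
by rewrite hmu// -[X in measurable X]setTI; exact: mf.
Qed.

Definition sqmod_entry (i j : 'I_m) (U : T) : R := sqmod (umx U i j).

Lemma measurable_sqmod_entry i j : measurable_fun [set: T]%classic (sqmod_entry i j).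
Proof. exact: (measurable_sqmod (cmeasurable_entry _ _ _)). Qed.

Lemma sum_sqmod_entry j U : \sum_i sqmod_entry i j U = 1.
Proof.
(* [unitarymx] speaks of rows; passing to the adjoint gives the columns. *)
have := umx_unitary U; rewrite -trmxC_unitary => /unitarymxP/matrixP/(_ j j).
rewrite !mxE eqxx => /(congr1 (@complex.Re R)) /= <-.
rewrite raddf_sum; apply: eq_bigr => i _; rewrite !mxE /sqmod_entry.
by case: (umx U i j) => a b; rewrite /sqmod /=; ring.
Qed.

Lemma sqmod_entry_ge0 i j U : 0 <= sqmod_entry i j U.
Proof. exact: sqmod_ge0. Qed.

Lemma sqmod_entry_le1 i j U : sqmod_entry i j U <= 1.
Proof.
rewrite -(sum_sqmod_entry j U) (bigD1 i)//= lerDl sumr_ge0// => k _; exact: sqmod_entry_ge0.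
Qed.

Lemma integrable_sqmod_entryM i k j :
  mu.-integrable [set: T]%classic (fun U => (sqmod_entry i j U * sqmod_entry k j U)%:E).
Proof.
apply: (@measurable_bounded_integrable _ _ _ _ (fun U => sqmod_entry i j U * sqmod_entry k j U)) => //.
- exact: le_lt_trans (probability_le1 mu measurableT) (ltry 1).
- exact: (measurable_funM (measurable_sqmod_entry _ _) (measurable_sqmod_entry _ _)).
- exists 1; split=> // M M1 U _ /=.
  rewrite ger0_norm ?mulr_ge0 ?sqmod_entry_ge0//.
  apply: le_trans (ltW M1); rewrite mulr_ile1 ?sqmod_entry_ge0 ?sqmod_entry_le1//.
Qed.

(** The column comes first, then the two rows. *)
Definition moment (j i k : 'I_m) : R := \int[mu]_U (sqmod_entry i j U * sqmod_entry k j U).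

Lemma EFin_moment j i k :
  ((moment j i k)%:E = \int[mu]_U (sqmod_entry i j U * sqmod_entry k j U)%:E)%E.
Proof. by rewrite /moment /Rintegral fineK//; exact: integrable_fin_num (integrable_sqmod_entryM _ _ _). Qed.

(** The double sum is the expectation of the squared norm of column [j], itself squared. *)
Lemma sum_moment j : \sum_i \sum_k moment j i k = 1.
Proof.
apply: EFin_inj; rewrite -sumEFin.
transitivity (\int[mu]_U (\sum_i \sum_k (sqmod_entry i j U * sqmod_entry k j U)%:E))%E.
  rewrite integral_sum//; last first.
    by move=> i; apply: integrable_sum => // k _; exact: integrable_sqmod_entryM.
  apply: eq_bigr => i _; rewrite integral_sum//; last by move=> k; exact: integrable_sqmod_entryM.
  by rewrite -sumEFin; apply: eq_bigr => k _; rewrite EFin_moment.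
under eq_integral => U _.
  under eq_bigr do rewrite sumEFin -mulr_sumr sum_sqmod_entry mulr1.
  rewrite sumEFin sum_sqmod_entry.
  over.
by rewrite integral_cst// mul1e; exact: probability_setT.
Qed.

Lemma umx_hadamard_mul (i k a j : 'I_m) (w : R[i]) (ik : i != k) (w1 : w * w^* = 1)
    (U : unitary R m) :
  umx (unitary_mul (mk_unitary (hadamard_mx_unitary ik w1)) U) a j
  = if a == i then ((Num.sqrt 2)^-1)%:C%C * (umx U i j + w * umx U k j)
    else if a == k then ((Num.sqrt 2)^-1)%:C%C * (umx U i j - w * umx U k j)
    else umx U a j.
Proof. by rewrite [LHS]mxE (sum_hadamard_mx _ _ _ _ (fun l => umx U l j)). Qed.

Lemma moment_sym j i k : moment j i k = moment j k i.
Proof. by apply: eq_Rintegral => U _; rewrite mulrC. Qed.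

(* Averaging over the four phases [w] kills every cross term of
   [|U_ij + w U_kj|^4] except [4 |U_ij|^2 |U_kj|^2]. *)
Lemma moment_hadamard j i k : i != k ->
  4 * moment j i i = moment j i i + moment j k k + 4 * moment j i k.
Proof.
move=> ik.
(* The fourth power of the modulus of entry [(i, j)] after the rotation; [2^-1] is the square of
   [1 / sqrt 2]. *)
pose G (w : R[i]) (U : T) := (2^-1 * sqmod (umx U i j + w * umx U k j)) ^+ 2.
have G0 w U : 0 <= G w U by rewrite sqr_ge0.
have mG w : measurable_fun [set: T]%classic (G w).
  apply: measurable_funX; apply: measurable_funM; first exact: measurable_cst.
  apply: measurable_sqmod; apply: cmeasurableD; first exact: cmeasurable_entry.
  by apply: cmeasurableM; [exact: cmeasurable_cst|exact: cmeasurable_entry].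
have GE w : w * w^* = 1 -> (\int[mu]_U (G w U)%:E = (moment j i i)%:E)%E.
  move=> w1; rewrite EFin_moment.
  have e U : sqmod_entry i j (unitary_mul (mk_unitary (hadamard_mx_unitary ik w1)) U)
      * sqmod_entry i j (unitary_mul (mk_unitary (hadamard_mx_unitary ik w1)) U) = G w U.
    rewrite /sqmod_entry umx_hadamard_mul eqxx sqmodM -expr2; congr ((_ * _) ^+ 2).
    by rewrite /sqmod /= expr0n addr0 exprVn sqr_sqrtr.
  rewrite -(@haar_integral_mul (mk_unitary (hadamard_mx_unitary ik w1))
    (fun U => sqmod_entry i j U * sqmod_entry i j U)).
  - by apply: eq_integral => U _; rewrite e.
  - by apply: measurable_funM; exact: measurable_sqmod_entry.
  - by rewrite (_ : (fun U : T => _) = G w) //; exact/funext.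
  - by move=> U; rewrite mulr_ge0 ?sqmod_entry_ge0.
pose ws : seq R[i] := [:: 1; -1; 'i%C; - 'i%C].
have ii : 'i%C * 'i%C^* = 1 :> R[i].
  by apply/eqP; rewrite eq_complex /=; apply/andP; split; apply/eqP; ring.
have wsP w : w \in ws -> w * w^* = 1.
  by rewrite !inE => /or4P[] /eqP ->; rewrite ?rmorphN ?rmorph1 ?mulrNN ?mulr1.
apply: EFin_inj.
(* Each of the four phases contributes one copy of [moment j i i]. *)
transitivity (\int[mu]_U (\sum_(w <- ws) (G w U)%:E))%E.
  rewrite ge0_integral_sum//; last 2 first.
  - by move=> w; apply/measurable_EFinP.
  - by move=> w U _; rewrite lee_fin.
  rewrite (eq_big_seq (fun=> (moment j i i)%:E)); last by move=> w /wsP; exact: GE.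
  by rewrite sumEFin !big_cons big_nil; congr (_%:E); ring.
transitivity (\int[mu]_U ((sqmod_entry i j U * sqmod_entry i j U)%:E + (sqmod_entry k j U * sqmod_entry k j U)%:E
     + 4%:E * (sqmod_entry i j U * sqmod_entry k j U)%:E))%E.
  apply: eq_integral => U _; rewrite sumEFin -EFinM -!EFinD; congr (_%:E).
  (* The factor [(1/2)^2] from [G] cancels the overall 4 of the phase identity. *)
  have := sum_sqr_sqmod_phases (umx U i j) (umx U k j).
  rewrite !big_cons big_nil /G /sqmod_entry !exprMn !addrA addr0 -!mulrDr => ->.
  by field.
have i1 := integrable_sqmod_entryM; have i2 := integrableZl measurableT 4 (i1 i k j).
rewrite integralD//; last by apply: integrableD.
by rewrite integralD// integralZl// -!EFin_moment -EFinM -!EFinD.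
Qed.

(** The relation of [moment_hadamard] and the one with [i] and [k] exchanged have the same
    right-hand side, which equates the two diagonal moments and then determines the mixed one. *)
Lemma moment_offdiag j i k : i != k -> moment j i k = moment j i i / 2 /\ moment j k k = moment j i i.
Proof.
move=> ik; have h1 := moment_hadamard j ik.
have h2 := @moment_hadamard j k i; rewrite eq_sym ik (moment_sym j k i) in h2.
have {}h2 := h2 isT.
by split; lra.
Qed.

(** All moments of a column reduce to a single [x], and [sum_moment] becomes
    [m x (1 + (m - 1) / 2) = 1]. *)
Lemma moment_diag j i : moment j i i = 2 / (m%:R * m.+1%:R).
Proof.
have m0 : (0 < m)%N by apply: leq_ltn_trans (ltn_ord i).
have d k : moment j k k = moment j i i.
  by have [->//|ki] := eqVneq k i; case: (moment_offdiag j (i := i) (k := k)); rewrite 1?eq_sym.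
have r k : \sum_l moment j k l = moment j i i * (1 + m.-1%:R / 2).
  rewrite (bigD1 k)//= (eq_bigr (fun=> moment j i i / 2)); last first.
    by move=> l lk; rewrite (moment_offdiag j _).1 ?d// eq_sym.
  by rewrite sumr_const cardC1 card_ord d -mulr_natl; ring.
have := sum_moment j; under eq_bigr do rewrite r.
rewrite sumr_const card_ord -[X in X = _]mulr_natl.
case: (m) m0 => // p _ /= h.
have p1 : (p.+1%:R : R) != 0 by rewrite pnatr_eq0.
have p2 : (p.+2%:R : R) != 0 by rewrite pnatr_eq0.
apply: (mulIf (mulf_neq0 p1 p2)); rewrite divfK ?mulf_neq0//.
transitivity (2 * (p.+1%:R * (moment j i i * (1 + p%:R / 2)))); last by rewrite h mulr1.
by rewrite -(natr1 p.+1) -(natr1 p); field.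
Qed.

End HaarMoments.

(** * The collision probability and its expectation *)

Lemma boson_prob_Bset_le (R : realType) m n (A : 'M[R[i]]_(m, n)) (i0 : 'I_m) :
  (forall j k, \sum_i A i j * (A i k)^* = (j == k)%:R) ->
  boson_prob A (Bset m n) <= n.-1%:R * \sum_i \sum_j sqmod (A i j) ^+ 2.
Proof.
(* The bound on permanents lives in [R[i]], so the real inequality is compared with it through the
   embedding. *)
move=> hA; rewrite -lecR.
have := sum_Bset_permanent_le hA i0; congr (_ <= _).
  rewrite /boson_prob rmorph_sum; apply: eq_bigr => S _ /=.
  by rewrite /boson_pmf sqr_normc_sqmod rmorphM fmorphV rmorph_nat /= sqmodE.
rewrite rmorphM rmorph_nat rmorph_sum; congr (_ * _); apply: eq_bigr => i _ /=.
rewrite rmorph_sum; apply: eq_bigr => j _ /=.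
by rewrite rmorphXn /= sqmodE -exprM.
Qed.

(** [mulmx1C] turns orthonormal rows into orthonormal columns; the entry is read at [(k, j)] because
    the conjugate falls on the first factor. *)
Lemma first_cols_orthonormal (R : realType) m n (hnm : (n <= m)%N) (U : 'M[R[i]]_m) j k :
  U \is unitarymx ->
  \sum_i first_cols hnm U i j * (first_cols hnm U i k)^* = (j == k)%:R.
Proof.
move=> UU; have /unitarymxP := UU; move=> /mulmx1C /matrixP /(_ (widen_ord hnm k) (widen_ord hnm j)).
rewrite !mxE -val_eqE /= val_eqE [k == j]eq_sym => <-.
by apply: eq_bigr => i _; rewrite !mxE mulrC.
Qed.

(** Each probability is the squared modulus of a polynomial in the entries of [U], up to a constant;
    [E \subset Phi m n] lets [repeat_rows] be read as a selection of rows. *)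
Lemma measurable_boson_prob (R : realType) m n (hnm : (n <= m)%N)
    (E : {set {ffun 'I_m -> 'I_n.+1}}) : E \subset Phi m n -> 'I_m ->
  measurable_fun [set: unitary_borel R m]%classic
    (fun U : unitary_borel R m => boson_prob (first_cols hnm (umx U)) E).
Proof.
move=> /fintype.subsetP EPhi i0; rewrite /boson_prob.
under eq_fun do rewrite big_mkcond.
apply: measurable_sum => S.
have [/EPhi SPhi|_] := boolP (S \in E); last exact: measurable_cst.
rewrite /boson_pmf.
under eq_fun do rewrite sqr_normc_sqmod (repeat_rowsE i0 SPhi).
apply: measurable_funM; last exact: measurable_cst.
apply: measurable_sqmod; apply: cmeasurable_sum => s.
apply: cmeasurable_prod => j.
under eq_fun do rewrite !mxE.
exact: cmeasurable_entry.
Qed.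

Unset Implicit Arguments.

Theorem theorem72 (R : realType) (m n : nat) (hn : (1 <= n)%N)
    (hnm : (n <= m)%N) (mu : probability (unitary_borel R m) R)
    (hmu : is_haar mu) :
  ('E_mu[fun U : unitary_borel R m =>
           boson_prob (first_cols hnm (umx U)) (Bset m n)]
     < (2 * n%:R ^+ 2 / m%:R)%:E)%E.
Proof.
have m0 : (0 < m)%N by apply: leq_trans hnm.
pose i0 := Ordinal m0.
pose w (j : 'I_n) := widen_ord hnm j.
rewrite unlock.
(* The pointwise bound of [boson_prob_Bset_le] is integrated over U(m). *)
apply: (@le_lt_trans _ _ (\int[mu]_U (n.-1%:R%:E *
    \sum_i \sum_(j < n) (sqmod_entry i (w j) U * sqmod_entry i (w j) U)%:E))%E).
  apply: ge0_le_integral => //.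
  - move=> U _; rewrite lee_fin; apply: sumr_ge0 => S _.
    by rewrite mulr_ge0 ?invr_ge0 ?ler0n ?sqr_ge0.
  - apply/measurable_EFinP; apply: measurable_boson_prob => //.
    exact: subsetDl.
  - apply: measurable_funeM; apply: emeasurable_sum => i; apply: emeasurable_sum => j.
    exact/measurable_int/integrable_sqmod_entryM.
  - move=> U _.
    under eq_bigr do rewrite sumEFin.
    rewrite sumEFin -EFinM lee_fin.
    have := boson_prob_Bset_le i0 (fun j k => first_cols_orthonormal hnm j k (umx_unitary U)).
    congr (_ <= _ * _); apply: eq_bigr => i _; apply: eq_bigr => j _.
    by rewrite mxE expr2.
have sint i : mu.-integrable [set: unitary_borel R m]%classic
    (fun U => \sum_(j < n) (sqmod_entry i (w j) U * sqmod_entry i (w j) U)%:E)%E.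
  by apply: integrable_sum => // j _; exact: integrable_sqmod_entryM.
rewrite integralZl//; last by apply: integrable_sum.
rewrite integral_sum//.
under eq_bigr => i _.
  rewrite integral_sum//; last by move=> j; exact: integrable_sqmod_entryM.
  (* All [n * m] fourth moments have the same value [2 / (m (m + 1))]. *)
  under eq_bigr do rewrite -EFin_moment moment_diag//.
  rewrite sumEFin sumr_const card_ord.
  over.
rewrite sumEFin sumr_const card_ord -EFinM lte_fin.
rewrite -mulrnA -[_ *+ (n * m)%N]mulr_natr natrM.
have mR : 0 < m%:R :> R by rewrite ltr0n.
have nR : 0 < n%:R :> R by rewrite ltr0n.
rewrite -subr_gt0.
have -> : n.-1%:R = n%:R - 1 :> R by rewrite -subn1 natrB.
rewrite -(natr1 m).
have m1 : m%:R + 1 != 0 :> R by rewrite natr1 pnatr_eq0.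
(* The bound reached is [2 n (n - 1) / (m + 1)]; its gap to the claimed one is a positive
   fraction. *)
have -> : 2 * n%:R ^+ 2 / m%:R - (n%:R - 1) * (2 / (m%:R * (m%:R + 1)) * (n%:R * m%:R))
   = 2 * n%:R * (n%:R + m%:R) / (m%:R * (m%:R + 1)) :> R.
  by field; rewrite m1 gt_eqF.
by rewrite divr_gt0 ?mulr_gt0 ?addr_gt0.
Qed.
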